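(* Let $N_a^{MC*}$, $N_{a0}^{AC*},N_{a1}^{AC*},N_{a2}^{AC*}$, $N_a^{m*}$ denote the equilibrium numbers of SAV commuters under marginal cost, average cost (three equilibria) and unregulated monopoly pricing, and $c^{MC*},c_0^{AC*},c_1^{AC*},c_2^{AC*},c^{m*}$ the corresponding equilibrium commuting costs. Suppose that $(AN-B)^2-4AF_a\ge0$. Then $$N_a^{MC*}>N_{a2}^{AC*}\ge N_a^{m*}\ge N_{a1}^{AC*}>N_{a0}^{AC*}=0$$ and $$c^{MC*}<c_2^{AC*}\le c^{m*}\le c_1^{AC*}<c_0^{AC*}.$$ If $(AN-B)^2-4AF_a>0$, all of these inequalities are strict. Suppose that $(AN-B)^2-4AF_a<0$. Then $$N_a^{MC*}>N_a^{m*}=N_{a0}^{AC*}=0,\qquad c^{MC*}<c^{m*}=c_0^{AC*}.$$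
   Context: A continuum of commuters of mass $N>0$ splits between normal vehicles (NV, mass $N_n\ge 0$) and shared autonomous vehicles (SAV, mass $N_a\ge0$), $N_n+N_a=N$, all passing a bottleneck of capacity $\mu>0$. Parameters: free-flow time $t_f\ge 0$; NV fixed cost $F_n\ge 0$; SAV waiting cost $w\ge 0$; SAV marginal operating cost $m\ge 0$; SAV fixed operating cost $F_a>0$; schedule-delay penalties $\beta,\gamma>0$; value-of-time parameter $\theta$ with $\beta<\theta<1$; capacity parameter $\kappa$ with $0<\kappa<1$. Given the split and the SAV fare $p$, the mode-specific commuting costs (in departure-time equilibrium) are $$c_n^*(N_n,N_a)=\frac{\beta\gamma}{\mu(\beta+\gamma)}(N_n+\kappa N_a)+t_f+F_n,\qquad c_a^*(N_n,N_a)=\frac{\beta\gamma}{\mu(\beta+\gamma)}(\theta N_n+\kappa N_a)+\theta t_f+p+w .$$ A mode-choice equilibrium is a split with $N_n,N_a\ge0$, $N_n+N_a=N$ such that $c_n^*=c_a^*$ if $N_n>0$ and $N_a>0$; $c_n^*\le c_a^*$ if $N_a=0$; $c_n^*\ge c_a^*$ if $N_n=0$. The equilibrium commuting cost is the common cost of the used modes (equal to $c_n^*$ whenever $N_n>0$). Set $A=\frac{\beta\gamma(1-\theta)}{(\beta+\gamma)\mu}$, $B=\theta t_f+m+w-(t_f+F_n)$. Standing assumption: $0<B<AN$. Fare scenarios and their equilibria: - Marginal cost (MC) pricing, $p=m$: $N_a^{MC*}=\frac{AN-B}{A}$. - Average cost (AC) pricing, $p=m+F_a/N_a$ (infinite at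 $N_a=0$): $N_{a0}^{AC*}=0$ always; and, when $(AN-B)^2\ge4AF_a$, also $N_{a1}^{AC*}=\frac{AN-B-K}{2A}$ and $N_{a2}^{AC*}=\frac{AN-B+K}{2A}$ with $K=\sqrt{(AN-B)^2-4AF_a}$. - Unregulated monopoly pricing: the provider maximizes $\pi=(p-m)N_a(p)-F_a$ with demand $N_a(p)=N-\frac{B+p-m}{A}$, giving $N_a^{m*}=\frac{AN-B}{2A}$ when $(AN-B)^2\ge 4AF_a$; when $(AN-B)^2<4AF_a$ the provider would incur a deficit and withdraws, and by convention $N_a^{m*}=0$ (all commuters use NVs). *)

(* Defs.v *)
From HB Require Import structures.
From mathcomp Require Import all_boot all_order all_algebra.
From mathcomp Require Import reals constructive_ereal.

Set Implicit Arguments.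
Unset Strict Implicit.
Unset Printing Implicit Defensive.

Import Order.TTheory GRing.Theory Num.Theory.
Local Open Scope ring_scope.

Record bottleneck (R : realType) := Bottleneck {
  total_mass : R;            (* N *)
  capacity : R;              (* mu *)
  free_flow_time : R;        (* t_f *)
  nv_fixed_cost : R;         (* F_n *)
  sav_waiting_cost : R;      (* w *)
  sav_marginal_cost : R;     (* m *)
  sav_fixed_cost : R;        (* F_a *)
  early_penalty : R;         (* beta *)
  late_penalty : R;          (* gamma *)
  sav_time_value : R;        (* theta *)
  sav_capacity_use : R       (* kappa *)
}.

Section Model.
Variables (R : realType) (M : bottleneck R).

Local Notation N := (total_mass M).
Local Notation mu := (capacity M).
Local Notation tf := (free_flow_time M).
Local Notation Fn := (nv_fixed_cost M).
Local Notation w := (sav_waiting_cost M).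
Local Notation m := (sav_marginal_cost M).
Local Notation Fa := (sav_fixed_cost M).
Local Notation beta := (early_penalty M).
Local Notation gamma := (late_penalty M).
Local Notation theta := (sav_time_value M).
Local Notation kappa := (sav_capacity_use M).

Definition coefA : R := beta * gamma * (1 - theta) / ((beta + gamma) * mu).
Definition coefB : R := theta * tf + m + w - (tf + Fn).

Local Notation A := coefA.
Local Notation B := coefB.

Record admissible : Prop := Admissible {
  N_gt0 : 0 < N;
  mu_gt0 : 0 < mu;
  tf_ge0 : 0 <= tf;
  Fn_ge0 : 0 <= Fn;
  w_ge0 : 0 <= w;
  m_ge0 : 0 <= m;
  Fa_gt0 : 0 < Fa;
  beta_gt0 : 0 < beta;
  gamma_gt0 : 0 < gamma;
  beta_lt_theta : beta < theta;
  theta_lt1 : theta < 1;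
  kappa_gt0 : 0 < kappa;
  kappa_lt1 : kappa < 1;
  B_gt0 : 0 < B;
  B_ltAN : B < A * N
}.

Definition nv_cost (Nn Na : R) : R :=
  beta * gamma / (mu * (beta + gamma)) * (Nn + kappa * Na) + tf + Fn.

(* Fares, hence SAV costs, are extended reals: the average cost fare is
   infinite when nobody uses SAVs. *)
Definition sav_cost (p : \bar R) (Nn Na : R) : \bar R :=
  ((beta * gamma / (mu * (beta + gamma)) * (theta * Nn + kappa * Na)
     + theta * tf)%:E + p + w%:E)%E.

(* A fare scenario maps the number of SAV commuters to the fare they pay. *)
Definition mode_choice_equilibrium (fare : R -> \bar R) (Nn Na : R) : Prop :=
  let cn := (nv_cost Nn Na)%:E in
  let ca := sav_cost (fare Na) Nn Na in
  [/\ 0 <= Nn, 0 <= Na & Nn + Na = N] /\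
  [/\ 0 < Nn -> 0 < Na -> cn = ca,
      Na = 0 -> (cn <= ca)%E
    & Nn = 0 -> (ca <= cn)%E].

Definition sav_equilibrium (fare : R -> \bar R) (Na : R) : Prop :=
  mode_choice_equilibrium fare (N - Na) Na.

(* The cost of a used mode; at an equilibrium it does not matter which one. *)
Definition equilibrium_cost (fare : R -> \bar R) (Na : R) : \bar R :=
  if 0 < N - Na then (nv_cost (N - Na) Na)%:E
  else sav_cost (fare Na) (N - Na) Na.

Definition discriminant : R := (A * N - B) ^+ 2 - 4 * A * Fa.
Local Notation K := (Num.sqrt discriminant).

Definition fare_MC (Na : R) : \bar R := m%:E.
Definition Na_MC : R := (A * N - B) / A.

Definition fare_AC (Na : R) : \bar R :=
  if Na == 0 then +oo%E else (m + Fa / Na)%:E.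
Definition Na_AC0 : R := 0.
(* Na_AC1 and Na_AC2 are meaningful only when 0 <= discriminant. *)
Definition Na_AC1 : R := (A * N - B - K) / (2 * A).
Definition Na_AC2 : R := (A * N - B + K) / (2 * A).

Definition demand (p : R) : R := N - (B + p - m) / A.
Definition profit (p : R) : R := (p - m) * demand p - Fa.

(* The provider withdraws, which amounts to an infinite fare, when even the
   profit-maximizing fare p leads to a deficit. *)
Definition monopoly_outcome (pm : \bar R) (Na : R) : Prop :=
  exists p : R, (forall q : R, profit q <= profit p) /\
    (if 0 <= profit p then pm = p%:E /\ Na = demand p
     else pm = +oo%E /\ Na = 0).

Definition Na_monopoly : R :=
  if 0 <= discriminant then (A * N - B) / (2 * A) else 0.

(* The first branch is the solution in p of demand p = Na_monopoly. *)
Definition price_monopoly : \bar R :=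
  if 0 <= discriminant then (m + (A * (N - Na_monopoly) - B))%:E else +oo%E.
Definition fare_monopoly (Na : R) : \bar R := price_monopoly.

Definition cost_MC : \bar R := equilibrium_cost fare_MC Na_MC.
Definition cost_AC0 : \bar R := equilibrium_cost fare_AC Na_AC0.
Definition cost_AC1 : \bar R := equilibrium_cost fare_AC Na_AC1.
Definition cost_AC2 : \bar R := equilibrium_cost fare_AC Na_AC2.
Definition cost_monopoly : \bar R := equilibrium_cost fare_monopoly Na_monopoly.

End Model.

(* Main.v *)
Require Import Defs.
From HB Require Import structures.
From mathcomp Require Import all_boot all_order all_algebra.
From mathcomp Require Import reals constructive_ereal.
From mathcomp Require Import ring lra.

Set Implicit Arguments.
Unset Strict Implicit.
Unset Printing Implicit Defensive.

Import Order.TTheory GRing.Theory Num.Theory.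
Local Open Scope ring_scope.

(** Everything is governed by one function of the number [Na] of SAV commuters,
    the surplus [A * (N - Na) - B].  At the fare [p], the SAV cost exceeds the
    NV cost by [p - m] minus the surplus ([sav_cost_fin]), so the surplus is the
    markup over marginal cost at which a split with [0 < Na < N] is an
    equilibrium.  For a markup that is at least [0] the corner where everybody
    uses SAVs is excluded by [0 < B], and the equilibria are described by
    [sav_equilibrium_fin]; at an infinite fare only [Na = 0] survives
    ([sav_equilibrium_infinite]).

    Each regime then amounts to an equation in one variable.  Marginal cost
    pricing asks that the surplus vanish.  Average cost pricing asks that
    [(A * (N - Na) - B) * Na = Fa]; completing the square turns this into
    [(2 * A * Na - (A * N - B)) ^+ 2 = discriminant], whence the two roots
    ([average_cost_roots]).  The monopoly profit is a concave quadratic in the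
    fare, with maximum [discriminant / (4 * A)], attained at the markup
    [(A * N - B) / 2] ([profitE], [profit_argmax]); hence the provider stays
    exactly when the discriminant is nonnegative, and its quantity is then the
    midpoint of the two average cost roots.

    The quantities are thus ordered because
    [0 <= Num.sqrt discriminant < A * N - B].  All of them are less than [N],
    so NVs are always used and every equilibrium cost is an NV cost, which is
    strictly decreasing in [Na] because a SAV uses less capacity than an NV
    ([kappa < 1]).  The order of the costs is therefore the reverse of that of
    the quantities. *)

Section Equilibria.
Variables (R : realType) (M : bottleneck R).
Hypothesis hM : admissible M.

Local Notation N := (total_mass M).
Local Notation m := (sav_marginal_cost M).
Local Notation Fa := (sav_fixed_cost M).
Local Notation A := (coefA M).
Local Notation B := (Defs.coefB M).
Local Notation D := (discriminant M).
Local Notation K := (Num.sqrt (discriminant M)).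

(** * Costs and equilibria for a given fare *)

Lemma coefA_gt0 : 0 < A.
Proof.
have [mu0 b0 g0 t1] :=
  And4 (mu_gt0 hM) (beta_gt0 hM) (gamma_gt0 hM) (theta_lt1 hM).
by rewrite /coefA divr_gt0 // !mulr_gt0 ?subr_gt0 ?addr_gt0.
Qed.

Lemma sav_cost_fin (p Na : R) :
  sav_cost M p%:E (N - Na) Na =
  (nv_cost M (N - Na) Na + (p - m - (A * (N - Na) - B)))%:E.
Proof.
have [mu0 b0 g0] := And3 (mu_gt0 hM) (beta_gt0 hM) (gamma_gt0 hM).
rewrite /sav_cost -!EFinD; congr (_%:E).
rewrite /nv_cost /coefA /Defs.coefB; field.
by rewrite !gt_eqF ?addr_gt0.
Qed.

Lemma sav_cost_infinite (Na : R) : sav_cost M +oo%E (N - Na) Na = +oo%E.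
Proof. by []. Qed.

(** The equilibrium conditions at a finite fare with markup at least [0],
    expressed by the surplus.  The corner [Na = N] has disappeared because the
    surplus there is [- B < 0]. *)
Lemma sav_equilibrium_fin (fare : R -> \bar R) (p Na : R) :
    fare Na = p%:E -> m <= p ->
  sav_equilibrium M fare Na <->
  [/\ 0 <= Na < N, 0 < Na -> A * (N - Na) - B = p - m
    & Na = 0 -> A * N - B <= p - m].
Proof.
have [N0 B0] := (N_gt0 hM, B_gt0 hM).
move=> fareE lemp; rewrite /sav_equilibrium /mode_choice_equilibrium fareE.
rewrite sav_cost_fin; split.
  move=> [[Nn0 Na0 _] [int cornerN cornerA]].
  have NaN : Na < N.
    rewrite lt_neqAle -[Na <= N]subr_ge0 Nn0 andbT; apply/eqP => NaE.
    have := cornerA; rewrite NaE subrr lee_fin => /(_ erefl); lra.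
  split; first by rewrite Na0.
  - move=> Na1; have := int; rewrite subr_gt0 => /(_ NaN Na1) []; lra.
  - move=> Na_eq0; have := cornerN Na_eq0; rewrite lee_fin Na_eq0 subr0; lra.
move=> [/andP[Na0 NaN] int cornerN]; split; first by split=> //; lra.
split=> [_ Na1|Na_eq0|NaN_eq0]; last by exfalso; lra.
- by congr (_%:E); have := int Na1; lra.
- rewrite lee_fin; have := cornerN Na_eq0; rewrite Na_eq0 subr0; lra.
Qed.

Lemma sav_equilibrium_infinite (fare : R -> \bar R) (Na : R) :
  fare Na = +oo%E -> sav_equilibrium M fare Na <-> Na = 0.
Proof.
have N0 := N_gt0 hM.
move=> fareE; rewrite /sav_equilibrium /mode_choice_equilibrium fareE.
rewrite sav_cost_infinite; split.
  move=> [[Nn0 Na0 _] [int _ cornerA]].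
  have [Na_gt0|] := ltP 0 Na; last by lra.
  have [Nn_gt0|Nn_le0] := ltP 0 (N - Na); first by have := int Nn_gt0 Na_gt0.
  by have /cornerA : N - Na = 0 by lra.
move=> ->; split; first by split; lra.
by split=> [_|_|Nn_eq0]; [rewrite ltxx | rewrite leey | exfalso; lra].
Qed.

(** An equilibrium at a markup that is at least [0] and less than the largest
    surplus [A * N - B] is interior, and unique. *)
Lemma sav_equilibrium_markup (fare : R -> \bar R) (p Na : R) :
    fare Na = p%:E -> 0 <= p - m < A * N - B ->
  sav_equilibrium M fare Na <-> Na = (A * N - B - (p - m)) / A.
Proof.
have [A0 B0] := (coefA_gt0, B_gt0 hM).
move=> fareE /andP[p0 pAN]; rewrite (sav_equilibrium_fin fareE); last by lra.
split=> [[/andP[Na0 NaN] int cornerN] | ->].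
  have Na_gt0 : 0 < Na.
    rewrite lt_neqAle Na0 andbT; apply/eqP => /esym /cornerN; lra.
  by rewrite -int //; field; rewrite gt_eqF.
have q0 : 0 < (A * N - B - (p - m)) / A by rewrite divr_gt0 // subr_gt0.
split; last by move=> qE; rewrite qE ltxx in q0.
- by rewrite (ltW q0) ltr_pdivrMr //; lra.
- by move=> _; field; rewrite gt_eqF.
Qed.

(** Moving one commuter from an NV to a SAV frees the capacity share
    [1 - kappa], so the NV cost is strictly decreasing in [Na]. *)
Lemma nv_cost_lt (x y : R) :
  (nv_cost M (N - x) x < nv_cost M (N - y) y) = (y < x).
Proof.
have [mu0 b0 g0 k1] :=
  And4 (mu_gt0 hM) (beta_gt0 hM) (gamma_gt0 hM) (kappa_lt1 hM).
have c0 : 0 < early_penalty M * late_penalty M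
              / (capacity M * (early_penalty M + late_penalty M)).
  by rewrite divr_gt0 ?mulr_gt0 ?addr_gt0.
rewrite /nv_cost !ltrD2r ltr_pM2l // -subr_gt0.
have -> : N - y + sav_capacity_use M * y - (N - x + sav_capacity_use M * x)
          = (1 - sav_capacity_use M) * (x - y) by ring.
by rewrite pmulr_rgt0 ?subr_gt0.
Qed.

Lemma equilibrium_cost_nv (fare : R -> \bar R) (Na : R) :
  Na < N -> equilibrium_cost M fare Na = (nv_cost M (N - Na) Na)%:E.
Proof. by move=> NaN; rewrite /equilibrium_cost subr_gt0 NaN. Qed.

Lemma equilibrium_cost_lt (f g : R -> \bar R) (x y : R) : x < N -> y < N ->
  (equilibrium_cost M f x < equilibrium_cost M g y)%E = (y < x).
Proof. by move=> xN yN; rewrite !equilibrium_cost_nv // lte_fin nv_cost_lt. Qed.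

Lemma equilibrium_cost_le (f g : R -> \bar R) (x y : R) : x < N -> y < N ->
  (equilibrium_cost M f x <= equilibrium_cost M g y)%E = (y <= x).
Proof.
by move=> xN yN; rewrite !equilibrium_cost_nv // lee_fin !leNgt nv_cost_lt.
Qed.

(** * Equilibria under marginal cost and average cost pricing *)

Lemma sav_equilibrium_MC (Na : R) :
  sav_equilibrium M (fare_MC M) Na <-> Na = Na_MC M.
Proof.
have BAN := B_ltAN hM.
rewrite (@sav_equilibrium_markup _ m) // /Na_MC subrr ?subr0 //.
by rewrite lexx subr_gt0.
Qed.

(** Under average cost pricing the surplus earned on all SAV commuters covers
    exactly the fixed cost.  Completing the square solves this equation; the
    formulas for the roots make sense only when [0 <= D]. *)
Lemma average_cost_roots (x : R) :
  (A * (N - x) - B) * x = Fa <->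
  0 <= D /\ (x = Na_AC1 M \/ x = Na_AC2 M).
Proof.
have A0 := coefA_gt0.
have A20 : 2 * A != 0 by rewrite gt_eqF // mulr_gt0.
have sqE : (2 * A * x - (A * N - B)) ^+ 2 - D
           = 4 * A * (Fa - (A * (N - x) - B) * x).
  by rewrite /discriminant; ring.
rewrite /Na_AC1 /Na_AC2; split=> [xE | [D0 xE]].
  move: sqE; rewrite xE subrr mulr0 => /subr0_eq sqE.
  have D0 : 0 <= D by rewrite -sqE sqr_ge0.
  split=> //.
  have /eqP : (2 * A * x - (A * N - B)) ^+ 2 = K ^+ 2 by rewrite sqr_sqrtr.
  rewrite eqf_sqr => /orP[] /eqP rootE; [right | left];
    by apply: (mulfI A20); rewrite mulrC [RHS]mulrC mulfVK //; lra.
have {xE} : (2 * A * x - (A * N - B)) ^+ 2 = K ^+ 2.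
  have A_neq0 : A != 0 by rewrite gt_eqF.
  by case: xE => ->; field.
have A40 : 4 * A != 0 by rewrite gt_eqF // mulr_gt0.
rewrite sqr_sqrtr // => rootE; apply/esym/subr0_eq/(mulfI A40).
by rewrite mulr0 -sqE rootE subrr.
Qed.

Lemma sav_equilibrium_AC (Na : R) :
  sav_equilibrium M (fare_AC M) Na <->
  (Na = Na_AC0 R \/ (0 <= D /\ (Na = Na_AC1 M \/ Na = Na_AC2 M))).
Proof.
have [A0 B0 Fa0] := And3 coefA_gt0 (B_gt0 hM) (Fa_gt0 hM).
rewrite -average_cost_roots /Na_AC0.
have [Na_eq0|Na_neq0] := eqVneq Na 0.
  rewrite sav_equilibrium_infinite; last by rewrite /fare_AC Na_eq0 eqxx.
  by split=> // _; left.
have fareE : fare_AC M Na = (m + Fa / Na)%:E.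
  by rewrite /fare_AC (negPf Na_neq0).
have markupE : m + Fa / Na - m = Fa / Na by rewrite addrC addKr.
have [Na_lt0|Na_gt0|Na_eq0] := ltgtP Na 0;
  last by rewrite Na_eq0 eqxx in Na_neq0.
  split=> [[[_ Na0 _] _]|[Na_eq0|rootE]]; [lra | lra |].
  (* a negative root is impossible: the surplus is positive for [Na < 0],
     whereas its product with [Na] is [Fa > 0] *)
  have : 0 < (A * (N - Na) - B) * Na by rewrite rootE.
  rewrite nmulr_lgt0 // => surplus_lt0.
  have : A * Na < 0 by rewrite pmulr_rlt0.
  have := B_ltAN hM; lra.
have avg_gt0 : 0 < Fa / Na by rewrite divr_gt0.
rewrite (sav_equilibrium_fin fareE) ?markupE; last by lra.
split=> [[_ int _] | [Na_eq0|rootE]]; [right | lra |].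
  by rewrite int // divfK.
have surplusE : A * (N - Na) - B = Fa / Na by rewrite -rootE mulfK.
split=> //; last by lra.
rewrite ltW //= -subr_gt0 -(pmulr_rgt0 _ A0); lra.
Qed.

(** * Monopoly pricing *)

(** The profit as a concave quadratic in the fare, written around its
    maximizer. *)
Lemma profitE (p : R) :
  profit M p = D / (4 * A) - (p - (m + (A * N - B) / 2)) ^+ 2 / A.
Proof.
by rewrite /profit /demand /discriminant; field; rewrite gt_eqF ?coefA_gt0.
Qed.

Lemma profit_argmax (p : R) :
  (forall q, profit M q <= profit M p) <-> p = m + (A * N - B) / 2.
Proof.
have A0 := coefA_gt0.
split=> [pmax | -> q]; last first.
  by rewrite !profitE subrr expr0n mul0r subr0 gerBl divr_ge0 ?sqr_ge0 ?ltW.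
have := pmax (m + (A * N - B) / 2).
rewrite !profitE subrr expr0n mul0r subr0 lerBrDl gerDr.
rewrite pmulr_lle0 ?invr_gt0 // => sq_le0.
by apply/eqP; rewrite -subr_eq0 -sqrf_eq0 eq_le sq_le0 sqr_ge0.
Qed.

Lemma profit_max : profit M (m + (A * N - B) / 2) = D / (4 * A).
Proof. by rewrite profitE subrr expr0n mul0r subr0. Qed.

Lemma demand_profit_max :
  demand M (m + (A * N - B) / 2) = (A * N - B) / (2 * A).
Proof. by rewrite /demand; field; rewrite gt_eqF ?coefA_gt0. Qed.

Lemma price_monopolyE :
  price_monopoly M = if 0 <= D then (m + (A * N - B) / 2)%:E else +oo%E.
Proof.
rewrite /price_monopoly /Na_monopoly; case: (0 <= D) => //.
by congr (_%:E); field; rewrite gt_eqF ?coefA_gt0.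
Qed.

Lemma monopoly_outcomeP (p : \bar R) (Na : R) :
  monopoly_outcome M p Na <-> p = price_monopoly M /\ Na = Na_monopoly M.
Proof.
have profit_ge0 : (0 <= profit M (m + (A * N - B) / 2)) = (0 <= D).
  by rewrite profit_max pmulr_lge0 // invr_gt0 mulr_gt0 ?coefA_gt0.
rewrite price_monopolyE /Na_monopoly /monopoly_outcome; split.
  move=> [q [/profit_argmax ->]].
  by rewrite profit_ge0 demand_profit_max; case: ifP.
move=> outE; exists (m + (A * N - B) / 2); split; first exact/profit_argmax.
by move: outE; rewrite profit_ge0 demand_profit_max; case: ifP.
Qed.

Lemma sav_equilibrium_monopoly (Na : R) :
  sav_equilibrium M (fare_monopoly M) Na <-> Na = Na_monopoly M.
Proof.
have [A0 BAN] := (coefA_gt0, B_ltAN hM).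
have fareE : fare_monopoly M Na = price_monopoly M by [].
move: fareE; rewrite price_monopolyE /Na_monopoly; case: ifP => _ fareE.
  rewrite (sav_equilibrium_markup fareE); last by lra.
  have -> : (A * N - B - (m + (A * N - B) / 2 - m)) / A = (A * N - B) / (2 * A).
    by field; rewrite gt_eqF.
  by [].
exact: sav_equilibrium_infinite.
Qed.

(** * Comparison of the regimes *)

Lemma sqrt_discriminant_lt : K < A * N - B.
Proof.
have BAN : 0 < A * N - B by rewrite subr_gt0 (B_ltAN hM).
rewrite -[ltRHS](@ger0_norm _ _) ?ltW // -sqrtr_sqr ltr_sqrt ?exprn_gt0 //.
by rewrite /discriminant gtrBl mulr_gt0 ?(Fa_gt0 hM) // mulr_gt0 ?coefA_gt0.
Qed.

Lemma Na_AC1_gt0 : 0 < Na_AC1 M.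
Proof.
have A20 : 0 < 2 * A by rewrite mulr_gt0 ?coefA_gt0.
by rewrite /Na_AC1 divr_gt0 // subr_gt0 sqrt_discriminant_lt.
Qed.

(** The midpoint [(A * N - B) / (2 * A)] is the monopoly quantity when
    [0 <= D].  The equality condition reads [D <= 0], not [D = 0], because the
    square root [K] is [0] by convention for [D < 0]. *)
Lemma Na_AC1_le_midpoint : Na_AC1 M <= (A * N - B) / (2 * A) ?= iff (D <= 0).
Proof.
have A20 : 0 < 2 * A by rewrite mulr_gt0 ?coefA_gt0.
split; first by rewrite ler_pM2r ?invr_gt0 // gerBl sqrtr_ge0.
have V20 : (2 * A)^-1 != 0 by rewrite invr_eq0 gt_eqF.
rewrite (inj_eq (mulIf V20)).
by rewrite -subr_eq0 addrC addKr oppr_eq0 sqrtr_eq0.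
Qed.

Lemma midpoint_le_Na_AC2 : (A * N - B) / (2 * A) <= Na_AC2 M ?= iff (D <= 0).
Proof.
have A20 : 0 < 2 * A by rewrite mulr_gt0 ?coefA_gt0.
split; first by rewrite ler_pM2r ?invr_gt0 // lerDl sqrtr_ge0.
have V20 : (2 * A)^-1 != 0 by rewrite invr_eq0 gt_eqF.
rewrite (inj_eq (mulIf V20)).
by rewrite eq_sym -subr_eq0 addrC addKr sqrtr_eq0.
Qed.

Lemma Na_AC2_lt_MC : Na_AC2 M < Na_MC M.
Proof.
have A0 := coefA_gt0; have K0 := sqrt_discriminant_lt.
have -> : Na_MC M = (A * N - B + (A * N - B)) / (2 * A).
  by rewrite /Na_MC; field; rewrite gt_eqF.
have V20 : 0 < (2 * A)^-1 by rewrite invr_gt0 mulr_gt0.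
by rewrite /Na_AC2 ltr_pM2r // ltrD2l.
Qed.

Lemma Na_MC_lt_total : Na_MC M < N.
Proof.
have [A0 B0] := (coefA_gt0, B_gt0 hM).
by rewrite ltr_pdivrMr //; lra.
Qed.

End Equilibria.

Theorem theorem1 (R : realType) (M : bottleneck R) (hM : admissible M) :
  [/\ forall Na : R, sav_equilibrium M (fare_MC M) Na <-> Na = Na_MC M,
      forall Na : R, sav_equilibrium M (fare_AC M) Na <->
        (Na = Na_AC0 R \/
         (0 <= discriminant M /\ (Na = Na_AC1 M \/ Na = Na_AC2 M))),
      forall (p : \bar R) (Na : R), monopoly_outcome M p Na <->
        (p = price_monopoly M /\ Na = Na_monopoly M)
    & forall Na : R, sav_equilibrium M (fare_monopoly M) Na <->
        Na = Na_monopoly M]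
  /\
  [/\ 0 <= discriminant M ->
        [/\ Na_MC M > Na_AC2 M, Na_AC2 M >= Na_monopoly M,
            Na_monopoly M >= Na_AC1 M, Na_AC1 M > Na_AC0 R & Na_AC0 R = 0]
        /\
        [/\ (cost_MC M < cost_AC2 M)%E, (cost_AC2 M <= cost_monopoly M)%E,
            (cost_monopoly M <= cost_AC1 M)%E & (cost_AC1 M < cost_AC0 M)%E],
      0 < discriminant M ->
        [/\ Na_MC M > Na_AC2 M, Na_AC2 M > Na_monopoly M,
            Na_monopoly M > Na_AC1 M & Na_AC1 M > Na_AC0 R]
        /\
        [/\ (cost_MC M < cost_AC2 M)%E, (cost_AC2 M < cost_monopoly M)%E,
            (cost_monopoly M < cost_AC1 M)%E & (cost_AC1 M < cost_AC0 M)%E]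
    & discriminant M < 0 ->
        [/\ Na_MC M > Na_monopoly M, Na_monopoly M = Na_AC0 R & Na_AC0 R = 0]
        /\
        ((cost_MC M < cost_monopoly M)%E /\ cost_monopoly M = cost_AC0 M)].
Proof.
split.
  split; [exact: sav_equilibrium_MC | exact: sav_equilibrium_AC
         | exact: monopoly_outcomeP | exact: sav_equilibrium_monopoly].
have [AC2_MC MC_N AC1_gt0] :=
  And3 (Na_AC2_lt_MC hM) (Na_MC_lt_total hM) (Na_AC1_gt0 hM).
have [AC1_mid mid_AC2] := (Na_AC1_le_midpoint hM, midpoint_le_Na_AC2 hM).
have AC2_N := lt_trans AC2_MC MC_N.
have mid_N := le_lt_trans mid_AC2 AC2_N.
have AC1_N := le_lt_trans AC1_mid mid_N.
have N0 := N_gt0 hM.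
have MC_gt0 : 0 < Na_MC M.
  apply: lt_trans AC2_MC; apply: lt_le_trans AC1_gt0 _.
  exact: le_trans AC1_mid mid_AC2.
split=> D0; rewrite /cost_MC /cost_AC0 /cost_AC1 /cost_AC2 /cost_monopoly.
- have monE :
    Na_monopoly M = (coefA M * total_mass M - Defs.coefB M) / (2 * coefA M).
    by rewrite /Na_monopoly D0.
  rewrite monE !equilibrium_cost_lt ?equilibrium_cost_le //.
  by do !split; rewrite ?AC1_mid ?mid_AC2.
- have monE :
    Na_monopoly M = (coefA M * total_mass M - Defs.coefB M) / (2 * coefA M).
    by rewrite /Na_monopoly ltW.
  have AC1_lt : Na_AC1 M < Na_monopoly M.
    by rewrite monE (lt_leif AC1_mid) -ltNge.
  have AC2_gt : Na_monopoly M < Na_AC2 M.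
    by rewrite monE (lt_leif mid_AC2) -ltNge.
  rewrite !equilibrium_cost_lt ?monE //.
  by rewrite -monE.
- have monE : Na_monopoly M = 0 by rewrite /Na_monopoly leNgt D0.
  rewrite monE !equilibrium_cost_nv // lte_fin nv_cost_lt //.
Qed.
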